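(* For every integer $t$, the formula $\phi(x;y)\equiv E(x,y)$ admits a definable abstract cell decomposition $\mathcal T$ in the structure $\mathbb M_t$ such that for every finite $S \subset M_t$ we have $|\mathcal T(S)| = |S|^{O(t)}$.
   Context: Let $\Sigma=\{E,\preceq\}$, $\Pi=\{E,\preceq,\widehat\preceq\}$. For a finite graph $G$, a total order $\preceq$ on $V(G)$ is a $t$-proper order if the adjacency matrix of $G$ (entries in $\{0,2\}$ encoding symmetric adjacency) with rows and columns ordered by $\preceq$ is $(t+2)$-symmetric-twin-ordered: contracting columns $i,j$ deletes column $j$ and replaces each entry of column $i$ by a red symbol $r$ where the two columns differ (similarly for rows); a symmetric contraction contracts rows $i,j$ and then columns $i,j$; the matrix is $k$-symmetric-twin-ordered if some sequence of symmetric contractions, each identifying consecutive rows and columns, reaches a $1\times1$ matrix with every intermediate matrix having at most $k$ red entries in each row and column. Let $(G_1,\preceq_{G_1}),(G_2,\preceq_{G_2}),\dots$ enumerate, up to isomorphism and with pairwise disjoint vertex sets, all finite $(G,\preceq_G)$ with $\preceq_G$ a $t$-proper order for $G$. $\mathbb M_t$ is the $\Pi$-structure with domain $M_t=\bigcup_iV(G_i)$, $E$ and $\preceq$ holding only within a single $G_i$ as $E_{G_i}$, $\preceq_{G_i}$, and $x\,\widehat\preceq\,y$ iff $x\in V(G_i)$, $y\in V(G_j)$ with $i<j$, or $i=j$ and $x\preceq_{G_i}y$. Abstract cell decompositions (in a structure $\mathbb M$, for a formula $\phi(\bar x;\bar y)$): a set $A$ crosses $X$ if both $X\cap A$ and $X\setminus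 A$ are non-empty; for $S\subseteq M^{|\bar y|}$, $\phi(\bar x;S)$ crosses $X$ if some $\phi(M;\bar s)=\{\bar b:\mathbb M\models\phi(\bar b;\bar s)\}$ with $\bar s\in S$ crosses $X$. An abstract cell decomposition for $\phi$ assigns to each finite $S\subseteq M^{|\bar y|}$ a finite family $\mathcal T(S)$ of subsets of $M^{|\bar x|}$ covering $M^{|\bar x|}$, none crossed by $\phi(\bar x;S)$. It is weakly definable if there is a finite set $\Psi$ of formulas $\psi(\bar x;\bar y_1,\dots,\bar y_k)$ with $|\bar y_i|=|\bar y|$ such that every $\Delta\in\mathcal T(S)$ equals $\psi(M;\bar s_1,\dots,\bar s_k)$ for some $\psi\in\Psi$ and $\bar s_1,\dots,\bar s_k\in S$. It is definable if moreover for each $\psi\in\Psi$ there is a formula $\theta_\psi(\bar y;\bar y_1,\dots,\bar y_k)$ such that, setting $\mathcal I(\Delta)=\theta_\psi(M;\bar s_1,\dots,\bar s_k)$ for $\Delta=\psi(M;\bar s_1,\dots,\bar s_k)$, for every finite $S$, $\mathcal T(S)$ is exactly the set of all such $\Psi$-definable $\Delta$ with parameters from $S$ satisfying $\mathcal I(\Delta)\cap S=\emptyset$. *)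

(* Defs.v *)
(* World: MathComp, with the classical sets of MathComp-Analysis and finmap. *)
From HB Require Import structures.
From mathcomp Require Import all_boot all_order all_algebra.
From mathcomp Require Import finmap.
From mathcomp Require Import boolp classical_sets.

Set Implicit Arguments.
Unset Strict Implicit.
Unset Printing Implicit Defensive.

Import Order.TTheory GRing.Theory Num.Theory.

Local Open Scope classical_set_scope.
Local Open Scope ring_scope.

(** * First-order logic with equality over a relational signature *)

Record signature := Signature { symbol : Type; arity : symbol -> nat }.

Record structure (L : signature) := Structure {
  domain :> choiceType;
  interp : forall r : symbol L, (arity r).-tuple domain -> Prop }.

(* [formula L V]: formulas whose free variables are indexed by [V].  In
   [FAll f] the bound variable of [f] is [None]. *)
Inductive formula (L : signature) (V : Type) : Type :=
| FFalse
| FEq of V & V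
| FRel (r : symbol L) of (arity r).-tuple V
| FImp of formula L V & formula L V
| FAll of formula L (option V).

Fixpoint sat (L : signature) (M : structure L) (V : Type) (f : formula L V) :
    (V -> M) -> Prop :=
  match f with
  | FFalse => fun _ => False
  | FEq u w => fun v => v u = v w
  | FRel r us => fun v => interp (map_tuple v us)
  | FImp f1 f2 => fun v => sat f1 v -> sat f2 v
  | FAll f1 => fun v =>
      forall a : M, sat f1 (fun u => if u is Some w then v w else a)
  end.

(** * Abstract cell decompositions *)

(* [formula1 L p q]: formulas phi(x; y) with |x| = p and |y| = q. *)
Definition formula1 (L : signature) (p q : nat) := formula L ('I_p + 'I_q).

(* [formulas L p q k]: formulas psi(x; y_1, ..., y_k) with |x| = p and
   |y_j| = q for every j. *)
Definition formulas (L : signature) (p q k : nat) :=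
  formula L ('I_p + 'I_k * 'I_q).

Section DefinableSets.
Variables (L : signature) (M : structure L) (p q : nat).

Definition defset1 (phi : formula1 L p q) (s : q.-tuple M) :
    set (p.-tuple M) :=
  [set b | sat phi (fun v => match v with
                             | inl i => tnth b i
                             | inr j => tnth s j
                             end)].

Definition defset (k : nat) (psi : formulas L p q k)
    (s : k.-tuple (q.-tuple M)) : set (p.-tuple M) :=
  [set b | sat psi (fun v => match v with
                             | inl i => tnth b i
                             | inr (j, l) => tnth (tnth s j) l
                             end)].

End DefinableSets.

Definition crosses (T : Type) (A X : set T) : Prop :=
  X `&` A !=set0 /\ X `\` A !=set0.

Section CellDecomposition.
Variables (L : signature) (M : structure L) (p q : nat).
Variable T : {fset q.-tuple M} -> {fset set (p.-tuple M)}.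

Definition cell_decomposition (phi : formula1 L p q) : Prop :=
  forall S : {fset q.-tuple M},
    \bigcup_(D in [set` T S]) D = setT /\
    forall D, D \in T S ->
      ~ exists2 s, s \in S & crosses (defset1 phi s) D.

(* A finite set of formulas, given as a family [psi] over a finite type.
   The number [k] of parameter blocks may depend on the formula: a single
   formula without parameters is needed to cover the space when S is empty. *)
Definition family_definable (J : finType) (k : J -> nat)
    (psi : forall j, formulas L p q (k j)) (S : {fset q.-tuple M})
    (D : set (p.-tuple M)) : Prop :=
  exists (j : J) (s : (k j).-tuple (q.-tuple M)),
    (forall i, tnth s i \in S) /\ D = defset (psi j) s.

Definition weakly_definable_by (J : finType) (k : J -> nat)
    (psi : forall j, formulas L p q (k j)) : Prop :=
  forall (S : {fset q.-tuple M}) D, D \in T S -> family_definable psi S D.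

(* [I] is required to be a function of the set D alone: whenever D has several
   presentations psi(M; s_1, ..., s_k), the formulas theta agree on them. *)
Definition definable : Prop :=
  exists (J : finType) (k : J -> nat) (psi : forall j, formulas L p q (k j)),
    weakly_definable_by psi /\
    exists (theta : forall j, formulas L q q (k j))
           (I : set (p.-tuple M) -> set (q.-tuple M)),
      (forall j (s : (k j).-tuple (q.-tuple M)),
         I (defset (psi j) s) = defset (theta j) s) /\
      forall (S : {fset q.-tuple M}) D,
        D \in T S <-> family_definable psi S D /\ I D `&` [set` S] = set0.

Definition definable_cell_decomposition (phi : formula1 L p q) : Prop :=
  cell_decomposition phi /\ definable.

End CellDecomposition.

(** * Symmetric-twin-ordered matrices *)

(* [None] is the red symbol r; in particular two red entries do not differ. *)
Definition entry := option nat.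

Definition contract_cols m n (i j : 'I_n) (A : 'M[entry]_(m, n)) :
    'M[entry]_(m, n.-1) :=
  col' j (\matrix_(x, y)
            if y == i then if A x i == A x j then A x i else None else A x y).

Definition contract_rows m n (i j : 'I_m) (A : 'M[entry]_(m, n)) :
    'M[entry]_(m.-1, n) :=
  (contract_cols i j A^T)^T.

Definition sym_contract n (i j : 'I_n) (A : 'M[entry]_n) : 'M[entry]_n.-1 :=
  contract_cols i j (contract_rows i j A).

Definition red_bounded (k : int) m n (A : 'M[entry]_(m, n)) : Prop :=
  (forall x, (#|[set y | A x y == None]|%SET)%:Z <= k) /\
  (forall y, (#|[set x | A x y == None]|%SET)%:Z <= k).

Fixpoint sym_twin_ordered (k : int) (n : nat) : 'M[entry]_n -> Prop :=
  match n with
  | 0 => fun _ => False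
  | n'.+1 => fun A =>
      red_bounded k A /\
      (n' = 0%N \/
       exists i j : 'I_n'.+1,
         j = i.+1 :> nat /\ sym_twin_ordered k (sym_contract i j A))
  end.

(** * Ordered graphs and proper orders *)

Definition vertex_display : Order.disp_t := Order.Disp tt tt.

(* A finite simple graph together with a total order on its vertices. *)
Record ordered_graph := OrderedGraph {
  vertex :> finOrderType vertex_display;
  edge : rel vertex;
  edge_sym : symmetric edge;
  edge_irrefl : irreflexive edge }.

Definition adjacency_mx (G : ordered_graph) : 'M[entry]_#|G| :=
  \matrix_(i, j)
    Some (if edge (Order.enum_val i) (Order.enum_val j) then 2%N else 0%N).

Definition proper_order (t : int) (G : ordered_graph) : Prop :=
  sym_twin_ordered (t + 2) (adjacency_mx G).

Definition og_iso (G H : ordered_graph) : Prop :=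
  exists f : G -> H,
    [/\ bijective f, forall x y, edge (f x) (f y) = edge x y
      & forall x y, (f x <= f y)%O = (x <= y)%O].

Definition enumerates (t : int) (G : nat -> ordered_graph) : Prop :=
  [/\ forall i, proper_order t (G i),
      forall H, proper_order t H -> exists i, og_iso H (G i)
    & forall i j, og_iso (G i) (G j) -> i = j].

(** * The structure M_t *)

Inductive Pi_symbol := SymE | SymLe | SymLeHat.

Definition Pi : signature := @Signature Pi_symbol (fun _ => 2%N).

Section UniversalStructure.
Variable G : nat -> ordered_graph.

Definition M_dom : choiceType := {i : nat & G i}.

Definition M_edge (x y : M_dom) : bool :=
  (tag x == tag y) && edge (tagged x) (tagged_as x y).

Definition M_le (x y : M_dom) : bool :=
  (tag x == tag y) && (tagged x <= tagged_as x y)%O.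

Definition M_lehat (x y : M_dom) : bool := (tag x < tag y)%N || M_le x y.

Definition M_struct : structure Pi :=
  @Structure Pi M_dom (fun r a =>
    let x := tnth a (0 : 'I_2) in
    let y := tnth a (1 : 'I_2) in
    match r with
    | SymE => M_edge x y
    | SymLe => M_le x y
    | SymLeHat => M_lehat x y
    end).

End UniversalStructure.

(* phi(x; y) := E(x, y), with |x| = |y| = 1 *)
Definition edge_formula : formula1 Pi 1 1 :=
  @FRel Pi ('I_1 + 'I_1) SymE [tuple inl ord0; inr ord0].

(* Main.v *)
(* The family T(S) of all cells, cut out by formulas of a fixed finite family
   with parameters in S, that no E(x; s) with s in S crosses is automatically a
   definable cell decomposition as soon as it covers: "E(x; y) crosses D" is a
   first-order condition on y depending only on the set D.  So it suffices to
   put every vertex x in an uncrossed cell given by O(t) parameters of S and one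
   of 2^O(t) formulas.

   Contract the graph of x until x stops being uniform (adjacent to all or to
   none) on the hull of the trace of S on some part R, say between s1 and s2 in
   R.  The set D of vertices that are not uniform between s1 and s2 meets only
   the at most t + 2 parts that are red to R.  Starting from A = D, as long as x
   is not already determined, take s in S outside the parts that are red to the
   part P of min A, with E(-, s) not constant on A up to x, and remove from A the
   initial segment on which E(-, s) is constant: it contains A meet P, so there
   are at most t + 2 such steps.  When they end, all vertices of the current
   initial segment of A agree with x on S outside the at most t + 2 parts red to
   P; and each of these is the union of at most two parts of the previous
   contraction, on whose traces x is uniform. *)
Require Import Defs.
From HB Require Import structures.
From mathcomp Require Import all_boot all_order all_algebra.
From mathcomp Require Import zify finmap.
From mathcomp Require Import boolp classical_sets.
Import Order.TTheory GRing.Theory Num.Theory.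
Set Implicit Arguments.
Unset Strict Implicit.
Unset Printing Implicit Defensive.
Local Open Scope ring_scope.

Fixpoint frename (L : signature) (V W : Type) (g : V -> W) (f : formula L V) :
    formula L W :=
  match f with
  | FFalse => FFalse L W
  | FEq u w => FEq L (g u) (g w)
  | FRel r us => FRel (map_tuple g us)
  | FImp f1 f2 => FImp (frename g f1) (frename g f2)
  | FAll f1 => FAll (frename (omap g) f1)
  end.

Lemma sat_frename (L : signature) (M : structure L) (V W : Type) (g : V -> W)
    (f : formula L V) (v : W -> M) : sat (frename g f) v <-> sat f (v \o g).
Proof.
elim: f W g v => {V} [V|V u w|V r us|V f1 IH1 f2 IH2|V f IH] W g v //=.
- suff -> : map_tuple v (map_tuple g us) = map_tuple (v \o g) us by [].
  by apply: val_inj; rewrite /= -map_comp.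
- by split=> h /IH1/h/IH2.
- have e a : (fun u : option W => if u is Some w then v w else a) \o omap g =
             (fun u => if u is Some w then (v \o g) w else a).
    by apply: funext => -[].
  by split=> h a; have := h a; rewrite IH e.
Qed.

Section Expressible.
Variables (L : signature) (M : structure L).

Definition expressible (V : Type) (P : (V -> M) -> Prop) :=
  exists f : formula L V, forall v, sat f v <-> P v.

Lemma expressible_iff V (P Q : (V -> M) -> Prop) :
  (forall v, P v <-> Q v) -> expressible P -> expressible Q.
Proof. by move=> PQ [f fP]; exists f => v; rewrite fP. Qed.

Lemma expressible_rename V W (g : V -> W) (P : (V -> M) -> Prop) :
  expressible P -> expressible (fun v : W -> M => P (v \o g)).
Proof. by move=> [f fP]; exists (frename g f) => v; rewrite sat_frename. Qed.

Lemma expressible_False V : expressible (fun _ : V -> M => False).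
Proof. by exists (FFalse L V). Qed.

Lemma expressible_imp V (P Q : (V -> M) -> Prop) :
  expressible P -> expressible Q -> expressible (fun v => P v -> Q v).
Proof.
move=> [f fP] [g gQ]; exists (FImp f g) => v /=.
by split=> h /fP/h/gQ.
Qed.

Lemma expressible_not V (P : (V -> M) -> Prop) :
  expressible P -> expressible (fun v => ~ P v).
Proof. by move=> eP; apply: expressible_imp => //; apply: expressible_False. Qed.

Lemma expressible_True V : expressible (fun _ : V -> M => True).
Proof.
by apply: expressible_iff (expressible_not (expressible_False V)) => v; tauto.
Qed.

Lemma expressible_and V (P Q : (V -> M) -> Prop) :
  expressible P -> expressible Q -> expressible (fun v => P v /\ Q v).
Proof.
move=> eP eQ.
apply: expressible_iff (expressible_not (expressible_imp eP (expressible_not eQ))).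
by move=> v; split=> [h|[hP hQ]]; [apply: contrapT => h'; apply: h => hP hQ; exact: h' | exact].
Qed.

Lemma expressible_or V (P Q : (V -> M) -> Prop) :
  expressible P -> expressible Q -> expressible (fun v => P v \/ Q v).
Proof.
move=> eP eQ.
apply: expressible_iff (expressible_imp (expressible_not eP) eQ) => v.
split=> [h|[hP /(_ hP)//|//]].
by case: (pselect (P v)) => [|/h]; [left|right].
Qed.

Lemma expressible_all V (P : (V -> M) -> M -> Prop) :
  expressible (fun v : option V -> M => P (v \o Some) (v None)) ->
  expressible (fun v => forall a, P v a).
Proof.
move=> [f fP]; exists (FAll f) => v.
by split=> h a; apply/(fP (fun u => if u is Some w then v w else a)); apply: h.
Qed.

Lemma expressible_ex V (P : (V -> M) -> M -> Prop) :
  expressible (fun v : option V -> M => P (v \o Some) (v None)) ->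
  expressible (fun v => exists a, P v a).
Proof.
move=> eP; apply: expressible_iff
  (expressible_not (expressible_all (P := fun v a => ~ P v a) (expressible_not eP))).
move=> v; split=> [h|[a Pa] /(_ a)//].
by apply: contrapT => h'; apply: h => a Pa; apply: h'; exists a.
Qed.

End Expressible.

Lemma seq_max (T : eqType) (f : T -> nat) (s : seq T) :
  s <> [::] -> exists2 a, a \in s & forall b, b \in s -> (f b <= f a)%N.
Proof.
elim: s => // a [|a' s] IH _.
  by exists a => [|b]; rewrite inE // => /eqP->.
have [//|c cs cmax] := IH; case: (leqP (f c) (f a)) => [ca|/ltnW ac].
  exists a; first by rewrite inE eqxx.
  by move=> b; rewrite inE => /orP[/eqP->//|/cmax/leq_trans]; apply.
exists c; first by rewrite inE cs orbT.
by move=> b; rewrite inE => /orP[/eqP->//|/cmax].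
Qed.

Section Stages.
Variable G : ordered_graph.
Implicit Types (x u v y s : G) (S : pred G) (K : seq (G * G)).

Definition uniform x S :=
  forall s1 s2 y, S s1 -> S s2 -> (s1 <= y)%O -> (y <= s2)%O -> edge x y = edge x s1.

Definition uniform_cover x S K :=
  (forall q, q \in K -> [/\ S q.1, S q.2 &
     forall y, (q.1 <= y)%O -> (y <= q.2)%O -> edge x y = edge x q.1]) /\
  (forall s, S s -> exists2 q, q \in K & (q.1 <= s <= q.2)%O).

Lemma uniform_coverP x S :
  uniform x S -> exists2 K, (size K <= 1)%N & uniform_cover x S K.
Proof.
move=> uS; case: (pickP S) => [s0 Ss0|S0]; last first.
  by exists [::] => //; split=> // s; rewrite S0.
case: (@Order.TotalTheory.arg_minP _ _ _ s0 S id Ss0) => a Sa amin.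
case: (@Order.TotalTheory.arg_maxP _ _ _ s0 S id Ss0) => b Sb bmax.
exists [:: (a, b)] => //; split=> [q|s Ss].
  by rewrite inE => /eqP->; split=> //= y; apply: (uS a b).
exists (a, b); first by rewrite inE.
by apply/andP; split; [exact: amin | exact: bmax].
Qed.

Lemma uniform_cover_cat x S1 S2 S K1 K2 :
  (forall s, S s = S1 s || S2 s) -> uniform_cover x S1 K1 ->
  uniform_cover x S2 K2 -> uniform_cover x S (K1 ++ K2).
Proof.
move=> eS [h1 c1] [h2 c2]; split=> [q|s].
  by rewrite mem_cat => /orP[/h1|/h2] [Sa Sb ?]; split=> //; rewrite eS ?Sa ?Sb ?orbT.
rewrite eS => /orP[/c1|/c2] [q qK qs]; exists q => //;
  by rewrite mem_cat qK ?orbT.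
Qed.

Lemma uniform_cover_parts x S (I : eqType) (p : G -> I) (c : nat) (rs : seq I) :
  (forall r, exists2 K, (size K <= c)%N &
     uniform_cover x [pred s | S s & p s == r] K) ->
  exists2 K, (size K <= c * size rs)%N &
    uniform_cover x [pred s | S s & p s \in rs] K.
Proof.
move=> h; elim: rs => [|r rs [K sK cK]].
  by exists [::] => //; split=> // s /=; rewrite andbF.
have [K' sK' cK'] := h r; exists (K' ++ K).
  by rewrite size_cat mulnS leq_add.
by apply: uniform_cover_cat cK' cK => s /=; rewrite inE andb_orr.
Qed.

Definition represents n (p : G -> 'I_n) (A : 'M[entry]_n) :=
  forall u v b, A (p u) (p v) = Some b -> b = if edge u v then 2%N else 0%N.

Lemma represents_uniform n (p : G -> 'I_n) (A : 'M[entry]_n) u u' v v' :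
  represents p A -> p u = p u' -> p v = p v' -> A (p u) (p v) != None ->
  edge u v = edge u' v'.
Proof.
move=> rA eu ev; case e: (A _ _) => [b|] // _.
have := rA _ _ _ e; have := rA u' v' b; rewrite -eu -ev e => /(_ erefl)->.
by case: edge; case: edge.
Qed.

Lemma contract_cols_Some m n (i j : 'I_n) (A : 'M[entry]_(m, n))
    (x : 'I_m) (y : 'I_n.-1) (y0 : 'I_n) b :
  lift j y = (if y0 == j then i else y0) ->
  contract_cols i j A x y = Some b -> A x y0 = Some b.
Proof.
rewrite !mxE => ey.
have [yi|] := eqVneq (lift j y) i.
  have [exy|//] := eqVneq (A x i) (A x j).
  by move: ey; have [->|_ <-] := eqVneq y0 j; rewrite ?yi -?exy.
by rewrite ey; have [|//] := eqVneq y0 j; rewrite eqxx.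
Qed.

Lemma represents_contract n (p : G -> 'I_n.+1) (A : 'M[entry]_n.+1) (i j : 'I_n.+1) :
  j = i.+1 :> nat -> {homo p : u v / (u <= v)%O >-> (u <= v)%N} -> represents p A ->
  exists p' : G -> 'I_n, [/\ {homo p' : u v / (u <= v)%O >-> (u <= v)%N},
    represents p' (sym_contract i j A) &
    forall u, lift j (p' u) = if p u == j then i else p u].
Proof.
move=> ij hp rA.
have [u|p' hp'] := @fin_all_exists _ (fun=> 'I_n)
    (fun u k => lift j k = if p u == j then i else p u).
  case: (unliftP j (if p u == j then i else p u)) => [k ->|]; first by exists k.
  have [_ /(congr1 val)/= e|/eqP//] := eqVneq (p u) j.
  by move: ij; rewrite e; lia.
exists p'; split=> // [u v /hp uv|u v b e].
  rewrite -(leq_bump2 j); have := congr1 val (hp' u); have := congr1 val (hp' v).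
  by rewrite /= => -> ->; do 2 (case: ifP; rewrite -val_eqE /=); lia.
have e1 := contract_cols_Some (hp' v) e.
rewrite mxE in e1.
have := contract_cols_Some (hp' u) e1; rewrite mxE.
exact: rA.
Qed.

(* The contraction at which [x] stops being uniform on the hull of the trace of
   [S] on each part: just before it, every part is the union of at most two
   parts on which [x] is uniform. *)
Lemma last_uniform_stage x S (k : int) n (A : 'M[entry]_n) (p : G -> 'I_n) :
  {homo p : u v / (u <= v)%O >-> (u <= v)%N} -> represents p A ->
  sym_twin_ordered k A ->
  (forall r, uniform x [pred s | S s & p s == r]) ->
  uniform x S \/
  exists m (q : G -> 'I_m) (B : 'M[entry]_m),
    [/\ {homo q : u v / (u <= v)%O >-> (u <= v)%N}, represents q B, red_bounded k B,
      exists s1 s2 y, [/\ S s1, S s2, q s1 = q s2, (s1 <= y <= s2)%O &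
        edge x y <> edge x s1] &
      forall r, exists2 K, (size K <= 2)%N &
        uniform_cover x [pred s | S s & q s == r] K].
Proof.
elim: n A p => [//|n IH] A p hp rA [_ ht] un.
case: ht => [n0|[i [j [ij tA]]]].
  left; subst n; move=> s1 s2 y S1 S2.
  by apply: (un (p s1)); rewrite /= ?S1 ?S2 !ord1 eqxx.
have [p' [hp' rA' pp']] := represents_contract ij hp rA.
case: (pselect (forall r, uniform x [pred s | S s & p' s == r])) => [un'|nun].
  exact: IH hp' rA' tA un'.
right; exists n, p', (sym_contract i j A); split=> //.
- by case: (n) (sym_contract i j A) tA => [//|n'] B [].
- apply: contrapT => no; apply: nun => r s1 s2 y /andP[S1 /eqP r1] /andP[S2 /eqP r2] h1 h2.
  apply: contrapT => ne; apply: no; exists s1, s2, y; split=> //.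
    by rewrite r1 r2.
  by rewrite h1.
move=> r.
have cov r0 : exists2 K, (size K <= 1)%N & uniform_cover x [pred s | S s & p s == r0] K.
  exact: uniform_coverP.
have [K sK cK] := uniform_cover_parts (if lift j r == i then [:: i; j] else [:: lift j r]) cov.
exists K; first by apply: leq_trans sK _; case: ifP.
have ep : [pred s | S s & p' s == r] =1
    [pred s | S s & p s \in if lift j r == i then [:: i; j] else [:: lift j r]].
  move=> s /=; congr (_ && _).
  rewrite -(inj_eq (@lift_inj _ j)) pp'.
  have nj : (j == lift j r) = false by apply/negbTE/neq_lift.
  have [->|nps] := eqVneq (p s) j; have [e|ne] := eqVneq (lift j r) i.
  - by rewrite !inE eqxx orbT.
  - by rewrite !inE nj.
  - by rewrite e !inE (negbTE nps) orbF.
  - by rewrite inE.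
case: cK => c1 c2; split=> [q /c1|s].
  by rewrite -!ep.
by rewrite ep => /c2.
Qed.

Lemma adjacency_last_uniform_stage x S (t : int) : proper_order t G ->
  uniform x S \/
  exists m (q : G -> 'I_m) (B : 'M[entry]_m),
    [/\ {homo q : u v / (u <= v)%O >-> (u <= v)%N}, represents q B,
      red_bounded (t + 2) B,
      exists s1 s2 y, [/\ S s1, S s2, q s1 = q s2, (s1 <= y <= s2)%O &
        edge x y <> edge x s1] &
      forall r, exists2 K, (size K <= 2)%N &
        uniform_cover x [pred s | S s & q s == r] K].
Proof.
move=> tG; apply: (last_uniform_stage (p := Order.enum_rank) _ _ tG).
- by move=> u v uv; have := Order.le_enum_rank (@le_total _ G) u v; rewrite uv.
- by move=> u v b; rewrite mxE !Order.enum_rankK => -[].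
move=> r s1 s2 y /andP[_ /eqP r1] /andP[_ /eqP r2] h1 h2.
suff -> : y = s1 by [].
apply: le_anti; rewrite h1 andbT.
by rewrite (Order.enum_rank_inj (etrans r1 (esym r2))).
Qed.

End Stages.

Inductive test := Skip | Split | After of bool | Const of bool | Beyond of bool.

Definition test_code (k : test) : bool * bool * bool :=
  match k with
  | Skip => (false, false, false)
  | Split => (false, false, true)
  | After e => (false, true, e)
  | Const e => (true, false, e)
  | Beyond e => (true, true, e)
  end.

Definition code_test (c : bool * bool * bool) : test :=
  match c with
  | (false, false, e) => if e then Split else Skip
  | (false, true, e) => After e
  | (true, false, e) => Const e
  | (true, true, e) => Beyond e
  end.

Lemma test_codeK : cancel test_code code_test.
Proof. by case. Qed.

HB.instance Definition _ := Equality.copy test (can_type test_codeK).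
HB.instance Definition _ := Choice.copy test (can_type test_codeK).
HB.instance Definition _ := Countable.copy test (can_type test_codeK).
HB.instance Definition _ := Finite.copy test (can_type test_codeK).

Lemma card_test : (#|{: test}| <= 2 ^ 3)%N.
Proof.
have := leq_card _ (can_inj test_codeK).
by rewrite !card_prod card_bool.
Qed.

Section Cells.
Variable G : nat -> ordered_graph.
Notation M := (M_struct G).
Implicit Types (A : M -> Prop) (x y z a b c : M) (e : bool).

Definition after A c z :=
  exists u v, [/\ A u, A v, M_lehat u z, M_lehat v z & M_edge u c <> M_edge v c].

Definition passes A (k : test) a b z : Prop :=
  match k with
  | Skip => True
  | Split => tag z = tag a /\
      exists y, [/\ M_lehat a y, M_lehat y b & M_edge z y <> M_edge z a]
  | After e => if e then after A a z else ~ after A a z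
  | Const e => tag z = tag a /\
      forall y, M_lehat a y /\ M_lehat y b -> M_edge z y = e
  | Beyond e => if e then (tag a < tag z)%N else (tag z < tag a)%N
  end.

Definition restrict A (q : test * M * M) : M -> Prop :=
  fun z => A z /\ passes A q.1.1 q.1.2 q.2 z.

Definition cell (l : seq (test * M * M)) : M -> Prop :=
  foldl restrict (fun _ => True) l.

Lemma expressible_edge V (a b : V) :
  expressible (fun v : V -> M => M_edge (v a) (v b)).
Proof. by exists (@FRel Pi V SymE [tuple a; b]). Qed.

Lemma expressible_edge_eq V (a b c d : V) :
  expressible (fun v : V -> M => M_edge (v a) (v b) = M_edge (v c) (v d)).
Proof.
have e1 := expressible_edge a b; have e2 := expressible_edge c d.
apply: expressible_iff
  (expressible_and (expressible_imp e1 e2) (expressible_imp e2 e1)) => v.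
by split=> [[h1 h2]|->//]; apply/idP/idP.
Qed.

Lemma expressible_lehat V (a b : V) :
  expressible (fun v : V -> M => M_lehat (v a) (v b)).
Proof. by exists (@FRel Pi V SymLeHat [tuple a; b]). Qed.

Lemma expressible_le V (a b : V) :
  expressible (fun v : V -> M => M_le (v a) (v b)).
Proof. by exists (@FRel Pi V SymLe [tuple a; b]). Qed.

Lemma tag_eqE a b : tag a = tag b <-> M_le a b \/ M_le b a.
Proof.
split; last by case=> /andP[/eqP e _].
case: a b => [i g] [j h] /= eij; case: _ / eij h => h.
rewrite /M_le /= eqxx !tagged_asE /=.
by apply/orP; exact: le_total.
Qed.

Lemma tag_ltE a b : (tag a < tag b)%N <-> ~ (tag a = tag b) /\ M_lehat a b.
Proof.
rewrite /M_lehat /M_le; split=> [ab|[ne /orP[//|/andP[/eqP/ne[]]]]].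
by rewrite ab; split=> // e; rewrite e ltnn in ab.
Qed.

Lemma expressible_tag V (a b : V) :
  expressible (fun v : V -> M => tag (v a) = tag (v b)).
Proof.
apply: expressible_iff (expressible_or (expressible_le a b) (expressible_le b a)).
by move=> v; rewrite tag_eqE.
Qed.

Lemma expressible_tag_lt V (a b : V) :
  expressible (fun v : V -> M => (tag (v a) < tag (v b))%N).
Proof.
apply: expressible_iff (expressible_and (expressible_not (expressible_tag a b))
  (expressible_lehat a b)).
by move=> v; rewrite tag_ltE.
Qed.

Lemma expressible_after V (A : (V -> M) -> M -> Prop) (a : V) :
  expressible (fun v : option V -> M => A (v \o Some) (v None)) ->
  expressible (fun v : option V -> M => after (A (v \o Some)) (v (Some a)) (v None)).
Proof.
move=> eA; apply: expressible_ex; apply: expressible_ex.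
pose gu (u : option V) : option (option (option V)) :=
  if u is Some w then Some (Some (Some w)) else Some None.
pose gv (u : option V) : option (option (option V)) :=
  if u is Some w then Some (Some (Some w)) else None.
have eu := expressible_rename gu eA; have ev := expressible_rename gv eA.
apply: expressible_iff (expressible_and eu (expressible_and ev (expressible_and
  (expressible_lehat (Some None) (Some (Some None)))
  (expressible_and (expressible_lehat None (Some (Some None)))
    (expressible_not (expressible_edge_eq (Some None) (Some (Some (Some a)))
      None (Some (Some (Some a))))))))).
by move=> v; split=> [[?[?[?[]]]]|[]].
Qed.

Lemma expressible_passes V (A : (V -> M) -> M -> Prop) k (a b : V) :
  expressible (fun v : option V -> M => A (v \o Some) (v None)) ->
  expressible (fun v : option V -> M =>
    passes (A (v \o Some)) k (v (Some a)) (v (Some b)) (v None)).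
Proof.
move=> eA; case: k => [||e|e|e] /=.
- exact: expressible_True.
- apply: expressible_and; first exact: expressible_tag.
  apply: expressible_ex.
  apply: expressible_iff (expressible_and (expressible_lehat (Some (Some a)) None)
    (expressible_and (expressible_lehat None (Some (Some b))) (expressible_not
      (expressible_edge_eq (Some None) None (Some None) (Some (Some a)))))).
  by move=> v; split=> [[?[? h]]|[? ? h]].
- have ea := expressible_after a eA.
  by case: e => //; apply: expressible_not.
- apply: expressible_and; first exact: expressible_tag.
  apply: expressible_all; apply: expressible_imp.
    by apply: expressible_and; apply: expressible_lehat.
  have ee := expressible_edge (Some None) (None : option (option V)).
  case: e; first exact: ee.
  by apply: expressible_iff (expressible_not ee) => v; split=> [/negP/negbTE|->].
- by case: e; apply: expressible_tag_lt.
Qed.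

Lemma expressible_cell V (l : seq (test * V * V)) :
  expressible (fun v : option V -> M =>
    cell [seq (q.1.1, v (Some q.1.2), v (Some q.2)) | q <- l] (v None)).
Proof.
rewrite /cell.
elim/last_ind: l => [|l q IH]; first exact: expressible_True.
apply: (@expressible_iff _ _ _ (fun v : option V -> M =>
  restrict (cell [seq (q.1.1, v (Some q.1.2), v (Some q.2)) | q <- l])
    (q.1.1, v (Some q.1.2), v (Some q.2)) (v None))).
  by move=> v; rewrite map_rcons foldl_rcons.
apply: expressible_and => //=.
exact: (expressible_passes (A := fun w : V -> M =>
  cell [seq (q.1.1, w q.1.2, w q.2) | q <- l])).
Qed.

Lemma lehat_refl x : M_lehat x x.
Proof. by case: x => i g; rewrite /M_lehat /M_le /= eqxx tagged_asE lexx orbT. Qed.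

Lemma lehat_existT i (g h : G i) :
  M_lehat (existT _ i g : M) (existT _ i h) = (g <= h)%O.
Proof. by rewrite /M_lehat /M_le /= ltnn eqxx tagged_asE. Qed.

Lemma lehat_leq x y : M_lehat x y -> (tag x <= tag y)%N.
Proof. by case/orP=> [/ltnW|/andP[/eqP e _]] //; rewrite e. Qed.

Lemma lehat_total x y : M_lehat x y \/ M_lehat y x.
Proof.
case: (ltngtP (tag x) (tag y)) => [xy|yx|].
- by left; rewrite /M_lehat xy.
- by right; rewrite /M_lehat yx.
by move/tag_eqE => [h|h]; [left|right]; rewrite /M_lehat h orbT.
Qed.

Lemma lehat_trans y x z : M_lehat x y -> M_lehat y z -> M_lehat x z.
Proof.
move=> xy yz; have := lehat_leq yz; have := lehat_leq xy.
rewrite leq_eqVlt => /orP[/eqP exy|lxy]; last first.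
  by move=> lyz; rewrite /M_lehat (leq_trans lxy lyz).
rewrite leq_eqVlt => /orP[/eqP eyz|lyz]; last by rewrite /M_lehat exy lyz.
case: x y z xy yz exy eyz => [i f] [j g] [k h] /= xy yz eij ejk.
move: ejk h yz; case: _ / eij g xy => g xy ejk; case: _ / ejk => h yz; move: xy yz.
by rewrite !lehat_existT; exact: le_trans.
Qed.

Lemma lehat_min (P : M -> Prop) x :
  P x -> exists2 z, P z & forall u, P u -> M_lehat z u.
Proof.
move=> Px; have exP : exists i, `[<exists2 z : M, P z & tag z = i>].
  by exists (tag x); apply/asboolP; exists x.
case: (ex_minnP exP) => i /asboolP[[j g] Pg /= eji] imin.
move: eji => eji; case: _ / eji imin => imin {i}.
have Pg1 : `[<P (existT _ j g)>] by apply/asboolP.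
case: (@Order.TotalTheory.arg_minP _ _ _ g (fun h => `[<P (existT _ j h)>]) id Pg1).
move=> h /asboolP Ph hmin; exists (existT _ j h) => // -[k u] Pu.
have := imin k; rewrite leq_eqVlt => /(_ _)/orP[].
- by apply/asboolP; exists (existT _ k u).
- move=> /eqP ejk; case: _ / ejk u Pu => u Pu.
  by rewrite lehat_existT; apply: hmin; apply/asboolP.
- by move=> lt_jk; rewrite /M_lehat /= lt_jk.
Qed.

(* Each [After true] step, applied with a parameter witnessing that the block
   is not yet uniform outside the exceptional set of the part containing its
   minimum, discards that part. *)
Lemma separate_block (S : M -> Prop) (I : eqType) (part : M -> I)
    (exc : I -> M -> Prop) (ps : seq I) A x :
  A x -> (forall z, A z -> part z \in ps) ->
  (forall u w z, A u -> A w -> A z -> M_lehat u w -> M_lehat w z ->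
     part u = part z -> part w = part u) ->
  (forall u v s, A u -> A v -> S s -> part u = part v -> ~ exc (part u) s ->
     M_edge u s = M_edge v s) ->
  exists l p, [/\ (size l <= size ps)%N,
    forall q, q \in l -> S q.1.2 /\ S q.2,
    foldl restrict A l x &
    forall x', foldl restrict A l x' -> forall s, S s -> ~ exc p s ->
      M_edge x' s = M_edge x s].
Proof.
elim: {ps}(size ps) {-2}ps (leqnn (size ps)) A => [|n IH] ps sps A Ax Aps conv hom.
  by have := Aps _ Ax; case: ps sps {Aps}.
have [w Aw wmin] := lehat_min Ax.
case: (pselect (exists s, [/\ S s, ~ exc (part w) s & after A s x])) => [[s [Ss nes sx]]|].
  have sub z : restrict A (After true, s, s) z -> A z by case.
  have pw z : restrict A (After true, s, s) z -> part z != part w.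
    move=> [Az [u [v [Au Av uz vz]]]]; apply: contra_not_neq => ezw.
    have eu : part u = part w by apply: (conv w u z); rewrite ?wmin.
    have ev : part v = part w by apply: (conv w v z); rewrite ?wmin.
    by apply: hom; rewrite ?eu.
  have srem : (size (rem (part w) ps) <= n)%N.
    by rewrite size_rem ?Aps//; case: (ps) sps.
  have remps z : restrict A (After true, s, s) z -> part z \in rem (part w) ps.
    move=> Az; have zps := Aps _ (sub _ Az); move: (pw _ Az) zps => {}pw.
    by rewrite (perm_mem (perm_to_rem (Aps _ Aw))) inE (negbTE pw).
  have [||l [p [sl lS lx lh]]] :=
      IH _ srem (restrict A (After true, s, s)) (conj Ax sx) remps.
  - by move=> u v z /sub + /sub + /sub; exact: conv.
  - by move=> u v t /sub + /sub; exact: hom.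
  exists ((After true, s, s) :: l), p; split=> //.
  - by move: sl; rewrite /= size_rem ?Aps//; case: (ps) (Aps _ Aw).
  - by move=> q; rewrite inE => /orP[/eqP->|/lS].
move=> none.
have same z s : A z -> M_lehat z x -> S s -> ~ exc (part w) s ->
    M_edge z s = M_edge x s.
  move=> Az zx Ss es; apply: contrapT => ne; apply: none; exists s; split=> //.
  by exists z, x; rewrite lehat_refl.
pose bad z := A z /\ exists s, [/\ S s, ~ exc (part w) s & after A s z].
case: (pselect (exists z, bad z)) => [[z0 /lehat_min[z [Az [s [Ss es sz]]] zmin]]|nbad].
  exists [:: (After false, s, s)], (part w); split=> //=.
  - by move: (Aps _ Aw); case: (ps).
  - by move=> q; rewrite inE => /eqP->.
  - by split=> // sx; apply: none; exists s.
  move=> x' [Ax' nsx'] s' Ss' es'.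
  apply: contrapT => ne.
  have [xx'|x'x] := lehat_total x x'; last by apply: ne; apply: same.
  have zx' : M_lehat z x'.
    apply: zmin; split=> //; exists s'; split=> //.
    by exists x', x; rewrite lehat_refl.
  case: sz => u [v [Au Av uz vz neuv]]; apply: nsx'.
  by exists u, v; split=> //; apply: lehat_trans zx'.
exists [::], (part w); split=> //= x' Ax' s Ss es.
have [xx'|x'x] := lehat_total x x'; last exact: same.
apply: contrapT => ne; apply: nbad; exists x'; split=> //; exists s; split=> //.
by exists x', x; rewrite lehat_refl.
Qed.


Lemma edge_existT i (g h : G i) :
  M_edge (existT _ i g : M) (existT _ i h) = edge g h.
Proof. by rewrite /M_edge /= eqxx tagged_asE. Qed.

Lemma edge_tag x y : tag x <> tag y -> M_edge x y = false.
Proof. by move=> /eqP/negbTE; rewrite /M_edge => ->. Qed.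

Lemma lehat_between i (g h : G i) y :
  M_lehat (existT _ i g) y -> M_lehat y (existT _ i h) ->
  exists2 u : G i, y = existT _ i u & (g <= u <= h)%O.
Proof.
move=> gy yh; have := lehat_leq yh; have := lehat_leq gy => /= i1 i2.
have : i = tag y by apply/eqP; rewrite eqn_leq i1 i2.
case: y gy yh {i1 i2} => j u gy yh /= ij; case: _ / ij u gy yh => u.
by rewrite !lehat_existT => gu uh; exists u; rewrite ?gu.
Qed.

Lemma restrict_sub A (l : seq (test * M * M)) z : foldl restrict A l z -> A z.
Proof. by elim: l A => //= q l IH A /IH[]. Qed.

Lemma foldl_const A (K : seq (bool * M * M)) z :
  foldl restrict A [seq (Const q.1.1, q.1.2, q.2) | q <- K] z <->
  A z /\ forall q, q \in K -> tag z = tag q.1.2 /\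
    forall y, M_lehat q.1.2 y /\ M_lehat y q.2 -> M_edge z y = q.1.1.
Proof.
elim: K A => [|q K IH] A /=; first by split=> [|[]].
rewrite IH; split=> [[[Az hq] hK]|[Az h]].
  by split=> // q'; rewrite inE => /orP[/eqP->|/hK].
by split; [split=> //; apply: h; rewrite inE eqxx | move=> q' q'K; apply: h; rewrite inE q'K orbT].
Qed.

Definition const_tests i (g : G i) (K : seq (G i * G i)) : seq (test * M * M) :=
  [seq (Const (edge g q.1), existT _ i q.1 : M, existT _ i q.2 : M) | q <- K].

Lemma const_testsP i (g : G i) (S : pred (G i)) K A z :
  uniform_cover g S K -> foldl restrict A (const_tests g K) z ->
  forall h, S h -> tag z = i /\
    M_edge z (existT _ i h) = M_edge (existT _ i g : M) (existT _ i h).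
Proof.
move=> [K1 K2]; rewrite /const_tests => + h Sh.
have -> : [seq (Const (edge g q.1), existT _ i q.1 : M, existT _ i q.2 : M) | q <- K] =
  [seq (Const q.1.1, q.1.2, q.2) | q <- [seq (edge g q.1, existT _ i q.1 : M,
    existT _ i q.2 : M) | q <- K]] by rewrite -map_comp.
case/foldl_const=> _ hz; have [q qK /andP[qh hq]] := K2 _ Sh.
have [/= tz ez] := hz _ (map_f _ qK); split=> //.
rewrite ez ?lehat_existT // edge_existT; have [_ _ e] := K1 _ qK.
by rewrite (e h).
Qed.

Lemma const_tests_self i (g : G i) (S : pred (G i)) K A :
  uniform_cover g S K -> A (existT _ i g) ->
  foldl restrict A (const_tests g K) (existT _ i g).
Proof.
move=> [K1 _] Ag; rewrite /const_tests.
have -> : [seq (Const (edge g q.1), existT _ i q.1 : M, existT _ i q.2 : M) | q <- K] =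
  [seq (Const q.1.1, q.1.2, q.2) | q <- [seq (edge g q.1, existT _ i q.1 : M,
    existT _ i q.2 : M) | q <- K]] by rewrite -map_comp.
apply/foldl_const; split=> // _ /mapP[q qK ->] /=; split=> // y [h1 h2].
have [u -> /andP[gu uh]] := lehat_between h1 h2.
by rewrite edge_existT; have [_ _ ->] := K1 _ qK.
Qed.

Lemma beyond_test (S : seq M) x e :
  exists l, [/\ (size l <= 1)%N, forall q, q \in l -> q.1.2 \in S /\ q.2 \in S &
    forall A z, foldl restrict A l z <-> A z /\ forall s, s \in S ->
      if e then (tag s < tag x)%N -> (tag s < tag z)%N
      else (tag x < tag s)%N -> (tag z < tag s)%N].
Proof.
have sub_le (p q r : nat) : (p <= r)%N -> (q <= r)%N -> (r - q <= r - p)%N -> (p <= q)%N.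
  by lia.
pose side (s : M) := if e then (tag s < tag x)%N else (tag x < tag s)%N.
have [noside|/eqP someside] := eqVneq (filter side S) [::].
  exists [::]; split=> // A z /=; split=> [Az|[]//]; split=> // s sS.
  have : s \notin filter side S by rewrite noside.
  by rewrite mem_filter sS andbT /side; case: e {side noside} => /negbTE->.
pose m := (\max_(s <- S) tag s)%N.
pose key (s : M) : nat := if e then tag s else (m - tag s)%N.
have [a + amax] := seq_max key someside.
rewrite mem_filter => /andP[sa aS].
have le_m s : s \in S -> (tag s <= m)%N by move=> sS; apply: leq_bigmax_seq.
exists [:: (Beyond e, a, a)]; split=> // [q|A z]; first by rewrite inE => /eqP->.
rewrite /= /restrict /=; split=> [[Az h]|[Az h]]; split=> //.
  move=> s sS; have := amax s; have := le_m _ sS; have := le_m _ aS.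
  rewrite mem_filter sS andbT /side /key; move: h.
  case: (e) => h h1 h2 /[swap] hs /(_ hs); first by move/leq_ltn_trans; apply.
  by move=> h3; apply: leq_trans h _; move: h1 h2 h3; apply: sub_le.
by have := h _ aS; move: sa; rewrite /side; case: (e) => sa; apply.
Qed.

Lemma red_bounded_size (t : int) m (B : 'M[entry]_m) : red_bounded (t + 2) B ->
  (forall p, (size (enum [pred r | B p r == None]) <= absz (t + 2)%R)%N) /\
  (forall r, (size (enum [pred p | B p r == None]) <= absz (t + 2)%R)%N).
Proof.
have e (p : pred 'I_m) : size (enum p) = #|[set r | p r]%SET|.
  by rewrite -cardE; apply: eq_card => r; rewrite inE.
by case=> h1 h2; split=> [p|r]; rewrite e; [have := h1 p | have := h2 r];
  move: #|_|; lia.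
Qed.

Lemma cell_cover (t : int) (S : seq M) x :
  (forall i, proper_order t (G i)) -> S <> [::] ->
  exists l, [/\ (size l <= 3 * absz (t + 2)%R + 2)%N,
    forall q, q \in l -> q.1.2 \in S /\ q.2 \in S, cell l x &
    forall z, cell l z -> forall s, s \in S -> M_edge z s = M_edge x s].
Proof.
move=> pG S0.
case: (pselect (exists2 s, s \in S & tag s = tag x)) => [[s0 s0S ts0]|none]; last first.
  have [l1 [sl1 l1S h1]] := beyond_test S x true.
  have [l2 [sl2 l2S h2]] := beyond_test S x false.
  exists (l1 ++ l2); split.
  - by rewrite size_cat; apply: leq_trans (leq_add sl1 sl2) _; rewrite leq_addl.
  - by move=> q; rewrite mem_cat => /orP[/l1S|/l2S].
  - by rewrite /cell foldl_cat; apply/h2; split=> //; apply/h1; split.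
  move=> z; rewrite /cell foldl_cat => /h2[/h1[_ z1] z2] s sS.
  have := z1 s sS; have := z2 s sS.
  have ne : tag s <> tag x by move=> e; apply: none; exists s.
  move=> h h'; rewrite !edge_tag => [//||e]; first by apply/nesym.
  by move: ne h h'; rewrite e; lia.
case: x ts0 => i g /= ts0; case: s0 ts0 s0S => [j h0] /= ji.
case: _ / (esym ji) h0 => h0 h0S.
pose Sg : pred (G i) := [pred h | (existT _ i h : M) \in S].
case: (adjacency_last_uniform_stage g Sg (pG i)) => [/uniform_coverP[K sK cK]|].
  exists (const_tests g K); split.
  - by rewrite size_map (leq_trans sK) //; lia.
  - by move=> q /mapP[q' /(proj1 cK)[? ? _] ->].
  - exact: (const_tests_self (A := fun=> True) cK).
  move=> z cz s sS; have cz' := const_testsP cK cz.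
  have [tz _] := cz' _ h0S.
  case: (eqVneq (tag s) i) => [|/eqP ts]; last first.
    by rewrite !edge_tag //= ?tz; apply/nesym.
  case: s sS => i1 s sS /= ejs; case: _ / (esym ejs) s sS => s sS.
  by have [_ ->] := cz' _ sS.
move=> [m [q [B [hq rB /red_bounded_size[row col] [s1 [s2 [y0 [S1 S2 q12 /andP[sy1 sy2] ne]]]] cov]]]].
have mid u v w : (u <= v)%O -> (v <= w)%O -> q u = q w -> q v = q u.
  move=> uv vw e; apply: val_inj; apply/eqP; rewrite eqn_leq.
  by rewrite {1}e !hq.
pose x : M := existT _ i g.
pose part (z : M) := q (tagged_as x z).
have partE h : part (existT _ i h) = q h by rewrite /part tagged_asE.
pose A := restrict (fun=> True) (Split, existT _ i s1 : M, existT _ i s2 : M).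
pose Sx (s : M) := (s \in S) /\ tag s = i.
pose ps := enum [pred p | B p (q s1) == None].
have AE z : A z -> exists2 h, z = existT _ i h & B (q h) (q s1) = None.
  case=> _ [/= + [y [ys1 ys2 nez]]]; case: z nez => i1 h nez /= ji'.
  case: _ / (esym ji') h nez => h nez.
  exists h => //; apply: contrapT => /eqP nB; apply: nez.
  have [u -> /andP[su us]] := lehat_between ys1 ys2.
  rewrite !edge_existT.
  by apply/esym; apply: (represents_uniform rB erefl _ nB); rewrite (mid s1 u s2).
have Ax : A x.
  split=> //; split=> //=; exists (existT _ i y0 : M).
  by rewrite !lehat_existT !edge_existT.
have Aps z : A z -> part z \in ps.
  by move=> /AE[h -> Bh]; rewrite partE mem_enum inE /= Bh.
have Aconv u w z : A u -> A w -> A z -> M_lehat u w -> M_lehat w z ->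
    part u = part z -> part w = part u.
  move=> /AE[u' -> _] /AE[w' -> _] /AE[z' -> _].
  by rewrite !lehat_existT !partE; exact: mid.
pose exc p (s : M) := B p (part s) = None.
have Ahom u v s : A u -> A v -> Sx s -> part u = part v -> ~ exc (part u) s ->
    M_edge u s = M_edge v s.
  move=> /AE[u' -> _] /AE[v' -> _] [_ ]; case: s => i1 s /= ej.
  case: _ / (esym ej) s => s; rewrite /exc !partE !edge_existT => euv /eqP nB.
  exact: (represents_uniform rB euv erefl nB).
have [l [p [sl lS lx lp]]] := separate_block Ax Aps Aconv Ahom.
have [K sK cK] := uniform_cover_parts (enum [pred r | B p r == None]) cov.
exists ((Split, existT _ i s1 : M, existT _ i s2 : M) :: l ++ const_tests g K); split.
- have add_bounds (a b c d k : nat) :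
      (a <= c -> c <= k -> b <= 2 * d -> d <= k -> (a + b).+1 <= 3 * k + 2)%N by lia.
  by rewrite /= size_cat size_map; apply: add_bounds sl (col _) sK (row p).
- move=> c; rewrite inE mem_cat => /or3P[/eqP->|/lS[[] ? _ [] ]|] //.
  case/mapP=> c1 /(proj1 cK)[/andP[c1S _] /andP[c2S _] _] ->.
  by split; [exact: c1S | exact: c2S].
- by rewrite /cell /= foldl_cat; exact: (const_tests_self cK lx).
move=> z; rewrite /cell /= foldl_cat => cz s sS.
have cl := restrict_sub cz.
have [h ez _] := AE _ (restrict_sub cl).
case: (eqVneq (tag s) i) => [|/eqP ts]; last first.
  by rewrite !edge_tag //= ?ez; apply/nesym.
case: s sS => i1 s sS /= ejs; case: _ / (esym ejs) s sS => s sS.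
case: (pselect (exc p (existT _ i s : M))) => [es|nes]; last exact: lp.
have ss : [pred s | Sg s & q s \in enum [pred r | B p r == None]] s.
  apply/andP; split; first exact: sS.
  by rewrite mem_enum inE /=; apply/eqP; move: es; rewrite /exc partE.
exact: (const_testsP cK cz ss).2.
Qed.

End Cells.

Definition valuation (T : Type) (p q k : nat) (s : k.-tuple (q.-tuple T))
    (b : p.-tuple T) (w : 'I_p + 'I_k * 'I_q) : T :=
  match w with inl i => tnth b i | inr (j, l) => tnth (tnth s j) l end.

Lemma expressible_defset (L : signature) (M : structure L) (p q k : nat)
    (P : ('I_p + 'I_k * 'I_q -> M) -> Prop) :
  expressible P -> exists psi : formulas L p q k, forall s : k.-tuple (q.-tuple M),
    defset psi s = [set b | P (valuation s b)]%classic.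
Proof.
by move=> [psi psiP]; exists psi => s; apply/seteqP; split=> b /psiP.
Qed.

Section EdgeCells.
Local Open Scope classical_set_scope.
Variable G : nat -> ordered_graph.
Notation M := (M_struct G).

Lemma edge_formulaE (s b : 1.-tuple M) :
  defset1 edge_formula s b = M_edge (tnth b ord0) (tnth s ord0).
Proof. by []. Qed.

Lemma tuple1E (b : 1.-tuple M) : b = [tuple tnth b ord0].
Proof. by apply: eq_from_tnth => i; rewrite !ord1. Qed.

Lemma crosses_definable k (psi : formulas Pi 1 1 k) :
  exists theta : formulas Pi 1 1 k, forall s : k.-tuple (1.-tuple M),
    defset theta s = [set y | crosses (defset1 edge_formula y) (defset psi s)].
Proof.
pose W := ('I_1 + 'I_k * 'I_1)%type.
pose g (w : W) : option W := if w is inr w' then Some (inr w') else None.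
have epsi : expressible (fun v : option W -> M =>
    sat psi (fun w => if w is inr _ then v (Some w) else v None)).
  apply: (@expressible_iff _ _ _ (fun v : option W -> M => sat psi (v \o g))).
    move=> v; suff -> : v \o g = fun w => if w is inr _ then v (Some w) else v None by [].
    by apply: funext => -[].
  by apply: (@expressible_rename _ _ _ _ g (fun v => sat psi v)); exists psi.
have ee := @expressible_edge G (option W) None (Some (inl ord0)).
have [theta thetaP] := expressible_defset (expressible_and
  (expressible_ex (P := fun (v : W -> M) a =>
     sat psi (fun w => if w is inr _ then v w else a) /\ M_edge a (v (inl ord0)))
    (expressible_and epsi ee))
  (expressible_ex (P := fun (v : W -> M) a =>
     sat psi (fun w => if w is inr _ then v w else a) /\ ~ M_edge a (v (inl ord0)))
    (expressible_and epsi (expressible_not ee)))).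
exists theta => s; rewrite thetaP.
have env (b y : 1.-tuple M) :
    (fun w : W => if w is inr _ then valuation s y w else tnth b ord0) = valuation s b.
  by apply: funext => -[i|[] //] /=; rewrite (ord1 i).
apply/seteqP; split=> y.
- have d a : sat psi (fun w : W => if w is inr _ then valuation s y w else a) ->
      defset psi s [tuple a].
    by move=> h; rewrite -[defset _ _ _]/(sat psi (valuation s [tuple a])) -(env _ y).
  by move=> [[a [ha ea]] [a' [ha' ea']]];
    split; [exists [tuple a] | exists [tuple a']]; split=> //; exact: d.
- have d b : defset psi s b -> sat psi (fun w : W =>
      if w is inr _ then valuation s y w else tnth b ord0) by rewrite env.
  by move=> [[b [hb eb]] [b' [hb' eb']]];
    split; [exists (tnth b ord0) | exists (tnth b' ord0)]; split=> //; exact: d.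
Qed.

Lemma cell_definable n (f : {ffun 'I_n -> test}) :
  exists psi : formulas Pi 1 1 (n + n), forall s : (n + n).-tuple (1.-tuple M),
    defset psi s = [set b | cell [seq (f i, tnth (tnth s (lshift n i)) ord0,
      tnth (tnth s (rshift n i)) ord0) | i <- enum 'I_n] (tnth b ord0)].
Proof.
pose V := ('I_(n + n) * 'I_1)%type.
pose g (w : option V) : 'I_1 + V := if w is Some w' then inr w' else inl ord0.
have [psi psiP] := expressible_defset (expressible_rename g
  (@expressible_cell G V
    [seq (f i, (lshift n i, ord0), (rshift n i, ord0)) | i <- enum 'I_n])).
exists psi => s; rewrite psiP; apply: funext => b; by rewrite /mkset -map_comp.
Qed.

Lemma cell_family_definable n :
  exists psi : forall j : option {ffun 'I_n -> test},
      formulas Pi 1 1 (if j is Some _ then n + n else 0)%N,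
    (forall s, defset (psi None) s = setT :> set (1.-tuple M)) /\
    forall f (s : (n + n).-tuple (1.-tuple M)), defset (psi (Some f)) s =
      [set b | cell [seq (f i, tnth (tnth s (lshift n i)) ord0,
        tnth (tnth s (rshift n i)) ord0) | i <- enum 'I_n] (tnth b ord0)].
Proof.
have [psi psiP] := fin_all_exists (@cell_definable n).
have [psi0 psi0P] := expressible_defset
  (@expressible_True Pi M ('I_1 + 'I_0 * 'I_1)).
exists (fun j => match j return
  formulas Pi 1 1 (if j is Some _ then n + n else 0)%N
  with Some f => psi f | None => psi0 end).
split=> [s|f s]; last exact: psiP.
by rewrite psi0P; apply/seteqP.
Qed.

Lemma pad_tests n (l : seq (test * M * M)) (a : M) (S : {fset 1.-tuple M}) :
  (size l <= n)%N -> [tuple a] \in S ->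
  (forall q, q \in l -> [tuple q.1.2] \in S /\ [tuple q.2] \in S) ->
  exists (f : {ffun 'I_n -> test}) (s : (n + n).-tuple (1.-tuple M)),
    (forall i, tnth s i \in S) /\
    forall x, cell [seq (f i, tnth (tnth s (lshift n i)) ord0,
      tnth (tnth s (rshift n i)) ord0) | i <- enum 'I_n] x <-> cell l x.
Proof.
move=> sl aS lS; pose d := (Skip, a, a); pose l' := l ++ nseq (n - size l) d.
have sl' : size l' = n by rewrite size_cat size_nseq subnKC.
have l'S q : q \in l' -> [tuple q.1.2] \in S /\ [tuple q.2] \in S.
  by rewrite mem_cat => /orP[/lS//|/nseqP[-> _]].
have nthS i : (i < n)%N -> [tuple (nth d l' i).1.2] \in S /\ [tuple (nth d l' i).2] \in S.
  by move=> ltin; apply: l'S; rewrite mem_nth ?sl'.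
exists [ffun i : 'I_n => (nth d l' i).1.1].
exists [tuple match split i with
  | inl j => [tuple (nth d l' j).1.2] | inr j => [tuple (nth d l' j).2] end | i < n + n].
split=> [i|x].
  by rewrite tnth_mktuple; case: (split i) => j; have [] := nthS j (ltn_ord j).
rewrite [X in cell X x](_ : _ = l'); last first.
  apply: (@eq_from_nth _ d); first by rewrite size_map size_enum_ord.
  move=> i; rewrite size_map size_enum_ord => ltin.
  rewrite (nth_map (Ordinal ltin)) ?size_enum_ord // ffunE !tnth_mktuple.
  rewrite (unsplitK (inl _)) (unsplitK (inr _)) /= nth_enum_ord //.
  by case: (nth d l' i) => [[]].
rewrite /cell foldl_cat; elim: (n - size l)%N (foldl _ _ l) => //= m IH A.
by rewrite IH; split=> [[]|].
Qed.

End EdgeCells.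

Theorem theorem5 :
  exists f : int -> nat,
    (exists c : nat, forall t : int, 1 <= t -> (f t)%:Z <= c%:Z * t) /\
    forall (t : int) (G : nat -> ordered_graph), enumerates t G ->
      exists T : {fset 1.-tuple (M_struct G)} ->
                 {fset set (1.-tuple (M_struct G))},
        definable_cell_decomposition T edge_formula /\
        forall S : {fset 1.-tuple (M_struct G)},
          (2 <= #|` S|)%N -> (#|` T S| <= #|` S| ^ f t)%N.
Proof.
pose slots (t : int) := (3 * absz (t + 2)%R + 2)%N.
exists (fun t => (5 * slots t + 1)%N); split.
  by exists 56%N => t t1; rewrite /slots; lia.
move=> t G [tG _ _]; set n := slots t.
have [psi [psi0 psi1]] := cell_family_definable G n.
pose inst (S : {fset 1.-tuple (M_struct G)})
    (c : {ffun 'I_n -> test} * (n + n).-tuple S) : set (1.-tuple (M_struct G)) :=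
  defset (psi (Some c.1)) (map_tuple val c.2).
pose uncrossed (S : {fset 1.-tuple (M_struct G)}) (D : set (1.-tuple (M_struct G))) :=
  forall s, s \in S -> ~ crosses (defset1 edge_formula s) D.
pose cells S := filter (fun D => `[< uncrossed S D >]) (setT :: [seq inst S c | c <- enum predT]).
have cellsP S D : D \in seq_fset tt (cells S) <->
    family_definable psi S D /\ uncrossed S D.
  rewrite seq_fsetE mem_filter; split.
    move=> /andP[/asboolP uD]; rewrite inE => /orP[/eqP eD|/mapP[c _ eD]]; split=> //.
      by exists None, [tuple]; split=> [[]//|]; rewrite psi0.
    exists (Some c.1), (map_tuple val c.2); split=> // i.
    by rewrite tnth_map; exact: valP.
  move=> [[[f|] [s [sS eD]]] uD]; apply/andP; split; try exact/asboolP.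
    rewrite inE; apply/orP; right; apply/mapP.
    exists (f, [tuple FSetSub (sS i) | i < n + n]); first by rewrite mem_enum.
    rewrite eD /inst; congr (defset _ _).
    by apply: eq_from_tnth => i; rewrite tnth_map tnth_mktuple.
  by rewrite inE eD psi0 eqxx.
have [theta thetaP] := fin_all_exists (fun j => crosses_definable G (psi j)).
exists (fun S => seq_fset tt (cells S)); split; first split.
- move=> S; split; last by move=> D /cellsP[_ uD] [s sS]; exact: uD.
  apply/seteqP; split=> // b _.
  have [/eqP S0|/fset0Pn[a aS]] := boolP (S == fset0).
    exists setT => //; apply/cellsP; split; last by move=> s; rewrite S0.
    by exists None, [tuple]; split=> [[]//|]; rewrite psi0.
  have SE (s : 1.-tuple (M_struct G)) : s = [tuple tnth s ord0] by exact: tuple1E.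
  have mapS x : (x \in [seq tnth s ord0 | s <- S]) = ([tuple x] \in S).
    apply/mapP/idP => [[s sS ->]|xS]; first by rewrite -SE.
    by exists [tuple x].
  have [|l [sl lS lb lE]] := cell_cover (S := [seq tnth s ord0 | s <- S])
      (tnth b ord0) tG.
    by move=> e; have := mapS (tnth a ord0); rewrite e -SE aS.
  have aS1 : [tuple tnth a ord0] \in S by rewrite -SE.
  have lS1 q : q \in l -> [tuple q.1.2] \in S /\ [tuple q.2] \in S.
    by move=> /lS; rewrite !mapS.
  have [f [s [sS sE]]] := pad_tests sl aS1 lS1.
  exists (defset (psi (Some f)) s); last by rewrite psi1; apply/sE.
  apply/cellsP; split; first by exists (Some f), s.
  move=> y yS; rewrite psi1 => -[[c [/sE lc yc]] [d [/sE ld yd]]]; apply: yd.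
  have yS1 : tnth y ord0 \in [seq tnth s ord0 | s <- S] by rewrite mapS -SE.
  by move: yc; rewrite !edge_formulaE (lE _ lc) // (lE _ ld).
- exists {: option {ffun 'I_n -> test}}, _, psi; split=> [S D /cellsP[]//|].
  exists theta, (fun D => [set y | crosses (defset1 edge_formula y) D]%classic).
  split=> [j s|S D]; first by rewrite thetaP.
  rewrite cellsP; split=> -[fD uD]; split=> //.
    by apply/seteqP; split=> // y [cy yS]; apply: uD cy.
  by move=> y yS cy; have : set0 y by rewrite -uD.
have n_gt0 : (0 < n)%N by rewrite /n /slots addn2.
move=> S S2; rewrite size_seq_fset.
apply: leq_trans (size_undup _) _; rewrite size_filter.
apply: leq_trans (count_size _ _) _.
rewrite /= size_map -cardE card_prod card_ffun card_tuple card_ord -cardfE.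
apply: (@leq_trans (#|` S| ^ (5 * n)).+1).
  rewrite ltnS (_ : 5 * n = 3 * n + (n + n))%N; last by lia.
  rewrite [leqRHS]expnD leq_mul2r; apply/orP; right.
  apply: (@leq_trans ((2 ^ 3) ^ n)).
    by rewrite leq_exp2r ?n_gt0; first exact: card_test.
  by rewrite expnM leq_exp2r // leq_exp2r.
rewrite addn1 expnS; move: #|` S| S2 => c c2.
have : (0 < c ^ (5 * n))%N by rewrite expn_gt0; case: c c2.
nia.
Qed.
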